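(* Let $X=(X_n:n\ge 0)$ be an irreducible recurrent Markov chain on a countable discrete state space $S$ with one-step transition matrix $P$, let $K\subseteq S$ be finite, let $z\in K$, and let $q:S\to\mathbb{R}_+$. Suppose there exist $v:S\to\mathbb{R}_+$ and $c<\infty$ such that $(Pv)(x)\le v(x)-q(x)+c\,I(x\in K)$ for all $x\in S$. Let $A_1\subset A_2\subset\cdots$ be finite subsets of $S$ with $K\subset A_1$ and $\bigcup_n A_n=S$, and let $\underline{\kappa}_n(x,q)$ and $\overline{\kappa}_n(x,q)$ be the quantities $\underline{\kappa}(x,q)$ and $\overline{\kappa}(x,q)$ defined in the context with truncation set $A=A_n$. Put $f(x)=\mathbb{E}_x\sum_{j=0}^{\tau(z)-1}q(X_j)$ for $x\in S-\{z\}$. Then: (i) for every $x\in S-\{z\}$, $\underline{\kappa}_n(x,q)$ (defined for all $n$ with $x\in A_n$) converges monotonically upward to $f(x)$ as $n\to\infty$; (ii) if in addition there exist $v':S\to\mathbb{R}_+$ and $c'<\infty$ such that $(Pv')(x)\le v'(x)-v(x)+c'\,I(x\in K)$ for all $x\in S$, then for every $x\in S-\{z\}$, $\overline{\kappa}_n(x,q)$ (defined for all sufficiently large $n$) converges to $f(x)$ as $n\to\infty$.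
   Context: $\mathbb{P}_x,\mathbb{E}_x$ denote probability and expectation conditional on $X_0=x$; functions are column vectors; $\tau(z)=\inf\{n\ge 1:X_n=z\}$. For a finite truncation set $A\supseteq K$, put $A'=A-K$, $\tilde K=K-\{z\}$, $A^c=S-A$. Partition $P$ according to $(K,A',A^c)$ into blocks $P_{ij}$, $1\le i,j\le 3$ (so $P_{12}$ is the $K\times A'$ block, $P_{22}$ the $A'\times A'$ block, $P_{21}$ the $A'\times K$ block, $P_{13}$ the $K\times A^c$ block, $P_{23}$ the $A'\times A^c$ block), and let $q_1,q_2,q_3$ and $v_1,v_2,v_3$ be the restrictions of $q$ and $v$ to $K,A',A^c$. The inverse $(I-P_{22})^{-1}=\sum_{n\ge 0}P_{22}^n$ exists by irreducibility. For a function $\rho$ on $\tilde K$, $\|\rho\|_{\tilde K}=\max\{|\rho(x)|:x\in\tilde K\}$ (taken to be $0$ if $\tilde K=\emptyset$). Definitions: - $G=(G(x,y):x,y\in\tilde K)$ with $G(x,y)=P(x,y)+(P_{12}(I-P_{22})^{-1}P_{21})(x,y)$; the inverse $(I-G)^{-1}=\sum_{n\ge0}G^n$ exists and is non-negative. - $k(x,q)=q_1(x)+(P_{12}(I-P_{22})^{-1}q_2)(x)$ for $x\in K$, and $k(x,q)=((I-P_{22})^{-1}q_2)(x)$ for $x\in A'$. - $\tilde k'(x,q)=(P_{13}v_3)(x)+(P_{12}(I-P_{22})^{-1}P_{23}v_3)(x)$ for $x\in K$, and $\tilde k'(x,q)=((I-P_{22})^{-1}P_{23}v_3)(x)$ for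 $x\in A'$. - $\beta(x,q)=k(x,q)+\tilde k'(x,q)$ for $x\in A$. - $\xi(x)=1-\sum_{y\in K}\big[P(x,y)+(P_{12}(I-P_{22})^{-1}P_{21})(x,y)\big]$ for $x\in\tilde K$, and $\xi(x)=1-\sum_{y\in K}((I-P_{22})^{-1}P_{21})(x,y)$ for $x\in A'$. Equivalently $\xi(x)=\mathbb{P}_x(T<T_K)$, where $T=\inf\{n\ge0:X_n\in A^c\}$ and $T_K=\inf\{n\ge1:X_n\in K\}$. In $(I-G)^{-1}\xi$, $\xi$ is the vector $(\xi(x):x\in\tilde K)$; likewise $\beta(q)=(\beta(x,q):x\in\tilde K)$ and $k(q)=(k(x,q):x\in\tilde K)$. - $\underline{\kappa}(q)=(I-G)^{-1}k(q)$ on $\tilde K$, with entries $\underline{\kappa}(x,q)$, and for $x\in A'$, $\underline{\kappa}(x,q)=k(x,q)+\sum_{y\in\tilde K}((I-P_{22})^{-1}P_{21})(x,y)\,\underline{\kappa}(y,q)$. - When $\|(I-G)^{-1}\xi\|_{\tilde K}<1$: on $\tilde K$, $\overline{\kappa}(q)=(I-G)^{-1}\beta(q)+(I-G)^{-1}\xi\;\dfrac{\|(I-G)^{-1}\beta(q)\|_{\tilde K}}{1-\|(I-G)^{-1}\xi\|_{\tilde K}}$, with entries $\overline{\kappa}(x,q)$, and for $x\in A'$, $\overline{\kappa}(x,q)=\beta(x,q)+\sum_{y\in\tilde K}((I-P_{22})^{-1}P_{21})(x,y)\,\overline{\kappa}(y,q)+\xi(x)\,\|\overline{\kappa}(q)\|_{\tilde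 K}$. The quantity $\overline{\kappa}_n(x,q)$ is considered only for $n$ with $x\in A_n$ and $\|(I-G)^{-1}\xi\|_{\tilde K}<1$ for $A=A_n$. *)

(* Defs.v *)
From HB Require Import structures.
From mathcomp Require Import all_boot all_order all_algebra.
From mathcomp Require Import finmap.
From mathcomp Require Import all_classical all_reals all_analysis.

Set Implicit Arguments.
Unset Strict Implicit.
Unset Printing Implicit Defensive.

Import Order.TTheory GRing.Theory Num.Theory.
Import numFieldNormedType.Exports.

Local Open Scope classical_set_scope.
Local Open Scope ring_scope.

Section Chain.
Context (R : realType) (S : countType).

Definition stochastic (P : S -> S -> R) : Prop :=
  (forall x y, 0 <= P x y) /\
  (forall x, \esum_(y in [set: S]) (P x y)%:E = 1%E).

Section Paths.
Context (d : measure_display) (Omega : measurableType d).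

(* [Pr x] is the law conditional on [X_0 = x].  The last clause is the Markov
   property P(X_{n+1} = y | X_0 = s_0, ..., X_n = s_n) = P(s_n, y), multiplied
   by the probability of the conditioning event so that null histories need
   no special treatment. *)
Definition markov_chain (P : S -> S -> R) (X : nat -> Omega -> S)
    (Pr : S -> probability Omega R) : Prop :=
  [/\ stochastic P,
      forall n (B : set S), measurable (X n @^-1` B),
      forall x, Pr x [set w | X 0%N w = x] = 1%E
    & forall x n (s : nat -> S) (y : S),
        Pr x [set w | (forall i, (i <= n)%N -> X i w = s i) /\ X n.+1 w = y]
        = (Pr x [set w | forall i, (i <= n)%N -> X i w = s i]
           * (P (s n) y)%:E)%E].

Definition irreducible_chain (X : nat -> Omega -> S)
    (Pr : S -> probability Omega R) : Prop :=
  forall x y, exists n, (0 < Pr x [set w | X n w = y])%E.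

(* The infimum of the empty set is [+oo]. *)
Definition tau (X : nat -> Omega -> S) (z : S) (w : Omega) : \bar R :=
  ereal_inf [set (n%:R)%:E | n in [set n : nat | (0 < n)%N /\ X n w = z]].

Definition recurrent_chain (X : nat -> Omega -> S)
    (Pr : S -> probability Omega R) : Prop :=
  forall x, Pr x [set w | (tau X x w < +oo)%E] = 1%E.

Definition cycle_reward (X : nat -> Omega -> S) (Pr : S -> probability Omega R)
    (z : S) (q : S -> R) (x : S) : \bar R :=
  (\int[Pr x]_w
     \esum_(j in [set j : nat | (j%:R)%:E < tau X z w]) (q (X j w))%:E)%E.

End Paths.

(* (P v)(x) is computed in [\bar R], so the bound includes its finiteness. *)
Definition drift (P : S -> S -> R) (K : {fset S}) (v q : S -> R) (c : R) :
    Prop :=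
  forall x, (\esum_(y in [set: S]) (P x y * v y)%:E
             <= (v x - q x + c * (x \in K)%:R)%:E)%E.

(* Entries, indexed by S and extended by 0, of the matrix inverse of
   [I - M], where [M] is restricted to [D x D]. *)
Definition inv_one_sub (D : {fset S}) (M : S -> S -> R) (x y : S) : R :=
  if (insub x : option D, insub y : option D) is (Some i, Some j)
  then invmx (1%:M - \matrix_(a < #|{: D}|, b < #|{: D}|)
                       M (val (enum_val a)) (val (enum_val b)))
         (enum_rank i) (enum_rank j)
  else 0.

Definition maxnorm (D : {fset S}) (rho : S -> R) : R :=
  \big[Num.max/0]_(x <- D) `|rho x|.

(* Throughout, (P_11, P_12, P_13; P_21, P_22, P_23; ...) is the block
   decomposition of P along (K, A', A^c).  Functions given by one formula on K
   and another on A' test [x \in K]; their values off A are meaningless. *)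
Section Truncation.
Context (P : S -> S -> R) (K : {fset S}) (z : S) (q v : S -> R) (A : {fset S}).

Definition Atrunc : {fset S} := (A `\` K)%fset.
Definition Ktilde : {fset S} := (K `\ z)%fset.

Definition invP22 : S -> S -> R := inv_one_sub Atrunc P.

(* ((I - P_22)^{-1} h)(x) *)
Definition invP22_app (h : S -> R) (x : S) : R :=
  \sum_(w <- Atrunc) invP22 x w * h w.

(* (P_12 h)(x) *)
Definition P12_app (h : S -> R) (x : S) : R := \sum_(u <- Atrunc) P x u * h u.

(* ((I - P_22)^{-1} P_21)(x, y) *)
Definition invP22_P21 (x y : S) : R := invP22_app (fun w => P w y) x.

(* P_11 + P_12 (I - P_22)^{-1} P_21; the matrix G is its restriction to
   [Ktilde], while [xi] sums it over all of [K]. *)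
Definition Gmx (x y : S) : R := P x y + P12_app (fun u => invP22_P21 u y) x.

Definition invG : S -> S -> R := inv_one_sub Ktilde Gmx.

Definition invG_app (h : S -> R) (x : S) : R :=
  \sum_(y <- Ktilde) invG x y * h y.

(* (P_13 v_3)(x) for x in K and (P_23 v_3)(x) for x in A'; the sum is finite
   as soon as (P v)(x) is. *)
Definition Pout (x : S) : R :=
  fine (\esum_(y in [set y | y \notin A]) (P x y * v y)%:E).

Definition kfun (x : S) : R :=
  if x \in K then q x + P12_app (invP22_app q) x else invP22_app q x.

Definition kout (x : S) : R :=
  if x \in K then Pout x + P12_app (invP22_app Pout) x else invP22_app Pout x.

Definition beta (x : S) : R := kfun x + kout x.

Definition xi (x : S) : R :=
  if x \in K then 1 - \sum_(y <- K) Gmx x y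
  else 1 - \sum_(y <- K) invP22_P21 x y.

Definition kappa_lo_K : S -> R := invG_app kfun.

Definition kappa_lo (x : S) : R :=
  if x \in K then kappa_lo_K x
  else kfun x + \sum_(y <- Ktilde) invP22_P21 x y * kappa_lo_K y.

Definition xi_norm : R := maxnorm Ktilde (invG_app xi).

Definition kappa_up_K (x : S) : R :=
  invG_app beta x
  + invG_app xi x * (maxnorm Ktilde (invG_app beta) / (1 - xi_norm)).

(* Meaningful only when [xi_norm < 1]. *)
Definition kappa_up (x : S) : R :=
  if x \in K then kappa_up_K x
  else beta x + \sum_(y <- Ktilde) invP22_P21 x y * kappa_up_K y
       + xi x * maxnorm Ktilde kappa_up_K.

End Truncation.
End Chain.

(* Main.v *)
Require Import Defs.
From HB Require Import structures.
From mathcomp Require Import all_boot all_order all_algebra.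
From mathcomp Require Import finmap.
From mathcomp Require Import all_classical all_reals all_analysis.
From mathcomp Require Import measurable_realfun.
From mathcomp Require Import ring lra.

Import Order.TTheory GRing.Theory Num.Theory.
Import numFieldNormedType.Exports.

Local Open Scope classical_set_scope.
Local Open Scope ring_scope.

(** Let [Q] be the transition matrix with column [z] deleted.  By the Markov
    property the expectation of [q (X_j)] on the event that the chain avoids
    [z] at times [1..j] is [(Q^j q)(x)], so the expected reward of a cycle is
    the Green function [sum_j Q^j q] ([cycle_reward_green]).  From here on the
    argument is about nonnegative matrices.  The Green function
    [green D h = sum_j P_D^j h] of a set [D] (only steps into [D] are allowed)
    is the least [u >= 0] with [h + P_D u <= u] ([green_le],
    [taboo_step_green_le]); it increases with [D] and, for finite rewards, is
    continuous along increasing unions ([green_cvg]).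

    Recurrence at [z] says that [Q^n 1] tends to 0 at [z]; the set of states
    where this holds is closed under one-step transitions, hence is everything
    by irreducibility ([stays_cvg0]).  If [Q^m 1 <= 1/2] on [K] and
    [s = sum_(k < m) Q^k 1], then [s - Q s = 1 - Q^m 1], so that
    [v + 2 |c| s] is a finite supersolution and the Green function of [q] is
    finite ([green_drift_fin]).

    For a truncation [A], put [B = A - {z}].  Block elimination shows that
    [kappa_lo], as a function of the reward [h], solves [u = h + P_B u] on [B]
    ([kappa_loP]).  As [P_B^n 1] tends to 0 this system has only one solution,
    namely [green B h] for [h >= 0] ([kappa_lo_green]), and the claims on
    [kappa_lo] follow from the monotonicity and continuity of Green functions.

    For the upper bounds, the ingredients of [kappa_up] on [K - {z}] are values of
    [kappa_lo] at other rewards, and on [A - K] the only further one is [xi],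
    which lies between 0 and [kappa_lo e] below ([xi_bounds]).  On
    [K - {z}] one has [(I - G)^{-1} xi = kappa_lo e], where [e] is the one-step
    probability of leaving [A]; this equals
    [1 - kappa_lo (P (., z))] ([kappa_lo_exit]), which tends to
    [1 - green (S - {z}) (P (., z)) = 0] by [green_hit].  Likewise
    [(I - G)^{-1} beta = kappa_lo q + kappa_lo (Pout v)], and since
    [green (S - {z}) v] is a supersolution of the truncated system with reward
    [v + Pout v], [kappa_lo (Pout v)] is at most
    [green (S - {z}) v - kappa_lo v] ([kappa_lo_Pout_le]).  The drift condition
    on [v'] makes [green (S - {z}) v] finite, so this difference tends to 0
    ([kappa_lo_cvg] for the reward [v]). *)

(** * Green functions of nonnegative matrices *)

Section ExtendedSums.
Local Open Scope ereal_scope.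
Context {R : realType} {T : choiceType}.
Implicit Types (I : set T) (a : T -> \bar R).

Lemma esumZl I (r : R) a : (0 <= r)%R -> (forall i, 0 <= a i) ->
  \esum_(i in I) (r%:E * a i) = r%:E * \esum_(i in I) a i.
Proof.
move=> r0 a0; rewrite /esum -ereal_supZl//; last first.
  by apply/set0P; exists (\sum_(i \in set0) a i) => /=; exists set0 => //; exact: fsets_set0.
congr ereal_sup; apply/seteqP; split => x /=.
  move=> [X IX <-]; exists (\sum_(i \in X) a i); first by exists X.
  by rewrite ge0_mule_fsumr.
by move=> [_ [X IX <-] <-]; exists X => //; rewrite ge0_mule_fsumr.
Qed.

(** Fatou's lemma for unordered sums. *)
Lemma esum_fatou I (a : nat -> T -> \bar R) (l : T -> \bar R) (c : \bar R) :
  (forall n i, 0 <= a n i) ->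
  (forall i, I i -> a n i @[n --> \oo] --> l i) ->
  (forall n, \esum_(i in I) a n i <= c) ->
  \esum_(i in I) l i <= c.
Proof.
move=> a0 al ac; apply: ge_ereal_sup => _ [X [finX XI] <-].
have cv : \sum_(i <- fset_set X | i \in fset_set X) a n i @[n --> \oo] -->
    \sum_(i <- fset_set X | i \in fset_set X) l i.
  apply: cvg_nnesum => i; first by move=> _; apply: nearW.
  by rewrite in_fset_set// inE => Xi; apply/al/XI.
rewrite fsbig_finite//= big_seq; apply: (cvge_le _ cv).
apply: nearW => n; apply: le_trans (ac n); rewrite -big_seq -fsbig_finite//.
by apply: ereal_sup_ubound; exists X.
Qed.

Lemma esum_fset_seq (D : {fset T}) a : (forall i, 0 <= a i) ->
  \esum_(i in [set` D]) a i = \sum_(i <- D) a i.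
Proof.
move=> a0; rewrite esum_fset; [|exact: finite_fset|by []].
by rewrite fsbig_finite/=; [rewrite set_fsetK | exact: finite_fset].
Qed.

Lemma esum_ge1 I a i : (forall j, 0 <= a j) -> I i -> a i <= \esum_(j in I) a j.
Proof.
move=> a0 Ii; rewrite (esumID [set i])//.
rewrite (_ : I `&` [set i] = [set i]); last by apply/seteqP; split=> x /= [] // ->.
by rewrite esum_set1// leeDl// esum_ge0.
Qed.

End ExtendedSums.

Section Taboo.
Local Open Scope ereal_scope.
Context {R : realType} {S : countType} (P : S -> S -> R).
Context (P0 : forall x y, (0 <= P x y)%R).
Implicit Types (D : set S) (h u : S -> \bar R) (x : S).

(** One step of the chain killed outside [D]: [(P_D h)(x)], where [P_D] keeps only
    the columns of [P] indexed by [D]. *)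
Definition taboo_step D h x : \bar R := \esum_(y in D) ((P x y)%:E * h y).

(** The Green function [sum_n P_D^n h], that is, the expected reward
    [E_x sum_(j < T) h (X_j)] up to the first time [T >= 1] outside [D]; the
    starting point [x] itself need not lie in [D]. *)
Definition green D h x : \bar R := \sum_(n <oo) iter n (taboo_step D) h x.

Lemma taboo_step_ge0 D h x : (forall y, 0 <= h y) -> 0 <= taboo_step D h x.
Proof. by move=> h0; apply: esum_ge0 => y _; rewrite mule_ge0 ?lee_fin. Qed.

Lemma iter_taboo_step_ge0 D h n x :
  (forall y, 0 <= h y) -> 0 <= iter n (taboo_step D) h x.
Proof.
by move=> h0; elim: n x => [//|n IH] x; rewrite iterS; exact: taboo_step_ge0.
Qed.

Lemma taboo_stepD D h u x : (forall y, 0 <= h y) -> (forall y, 0 <= u y) ->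
  taboo_step D (fun y => h y + u y) x = taboo_step D h x + taboo_step D u x.
Proof.
move=> h0 u0; rewrite /taboo_step -esumD.
- by apply: eq_esum => y _; rewrite ge0_muleDr.
- by move=> y _; rewrite mule_ge0 ?lee_fin.
- by move=> y _; rewrite mule_ge0 ?lee_fin.
Qed.

Lemma taboo_stepZ D (r : R) h x : (0 <= r)%R -> (forall y, 0 <= h y) ->
  taboo_step D (fun y => r%:E * h y) x = r%:E * taboo_step D h x.
Proof.
move=> r0 h0; rewrite /taboo_step -esumZl//; last first.
  by move=> y; rewrite mule_ge0 ?lee_fin.
by apply: eq_esum => y _; rewrite muleCA.
Qed.

Lemma le_taboo_step D D' h u x : (forall y, 0 <= u y) ->
  D `<=` D' -> (forall y, D y -> h y <= u y) ->
  taboo_step D h x <= taboo_step D' u x.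
Proof.
move=> u0 DD hu; apply: (@le_trans _ _ (taboo_step D u x)).
  by apply: le_esum => y Dy; rewrite lee_wpmul2l ?lee_fin// hu.
rewrite /taboo_step esum_mkcond [leRHS]esum_mkcond; apply: le_esum => y _.
have [yD|yD] := boolP (y \in D).
  by rewrite ifT// inE; apply: DD; rewrite inE in yD.
by case: ifP => // _; rewrite mule_ge0 ?lee_fin.
Qed.

Lemma le_iter_taboo_step D D' h u n x :
  (forall y, 0 <= h y) -> D `<=` D' -> (forall y, h y <= u y) ->
  iter n (taboo_step D) h x <= iter n (taboo_step D') u x.
Proof.
move=> h0 DD hu; have u0 y : 0 <= u y by exact: le_trans (hu y).
elim: n x => [|n IH] x; first exact: hu.
rewrite !iterS; apply: le_taboo_step => //.
by move=> y; exact: iter_taboo_step_ge0.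
Qed.

Lemma le_green D D' h u x :
  (forall y, 0 <= h y) -> D `<=` D' -> (forall y, h y <= u y) ->
  green D h x <= green D' u x.
Proof.
move=> h0 DD hu; apply: lee_nneseries => n _.
  by move=> _; exact: iter_taboo_step_ge0.
exact: le_iter_taboo_step.
Qed.

Lemma green_ge0 D h x : (forall y, 0 <= h y) -> 0 <= green D h x.
Proof. by move=> h0; apply: nneseries_ge0 => n _ _; exact: iter_taboo_step_ge0. Qed.

Lemma taboo_step_sum D (f : nat -> S -> \bar R) n x :
  (forall k y, 0 <= f k y) ->
  taboo_step D (fun y => \sum_(0 <= k < n) f k y) x =
  \sum_(0 <= k < n) taboo_step D (f k) x.
Proof.
move=> f0; elim: n => [|n IH].
  rewrite big_nil /taboo_step esum1// => y _.
  by rewrite big_nil mule0.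
rewrite big_nat_recr//= -IH -taboo_stepD//.
  by apply: eq_esum => y _; rewrite big_nat_recr.
by move=> y; apply: sume_ge0.
Qed.

Lemma sum_iter_taboo_stepS D h n x : (forall y, 0 <= h y) ->
  \sum_(0 <= k < n.+1) iter k (taboo_step D) h x =
  h x + taboo_step D (fun y => \sum_(0 <= k < n) iter k (taboo_step D) h y) x.
Proof.
move=> h0; rewrite big_nat_recl//= taboo_step_sum//.
by move=> k y; exact: iter_taboo_step_ge0.
Qed.

(** The Green function is below every nonnegative supersolution. *)
Lemma green_le D h u x : (forall y, 0 <= h y) -> (forall y, 0 <= u y) ->
  (forall y, h y + taboo_step D u y <= u y) -> green D h x <= u x.
Proof.
move=> h0 u0 hu; apply: lime_le.
  by apply: is_cvg_nneseries => n _ _; exact: iter_taboo_step_ge0.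
apply: nearW => n; elim: n x => [|n IH] x; first by rewrite big_nil.
rewrite sum_iter_taboo_stepS//; apply: le_trans (hu x).
by rewrite leeD2l// le_taboo_step.
Qed.

Lemma sum_le_green D h n x : (forall y, 0 <= h y) ->
  \sum_(0 <= k < n) iter k (taboo_step D) h x <= green D h x.
Proof.
by move=> h0; apply: nneseries_lim_ge => k _ _; exact: iter_taboo_step_ge0.
Qed.

Lemma taboo_step_green_le D h x : (forall y, 0 <= h y) ->
  h x + taboo_step D (green D h) x <= green D h x.
Proof.
move=> h0.
have C k y : 0 <= iter k (taboo_step D) h y by exact: iter_taboo_step_ge0.
(* An infinite [h x] makes the right-hand side infinite and is set apart, since the
   finite case subtracts [h x]. *)
have [hx|hx] := boolP (h x \is a fin_num); last first.
  rewrite (_ : green D h x = +oo) ?leey//.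
  apply/eqP; rewrite -leye_eq; apply: le_trans (sum_le_green D _ 1%N x h0).
  by rewrite big_nat1/=; move: hx (h0 x); case: (h x).
rewrite -leeBrDl//.
apply: (@esum_fatou _ _ _
  (fun n y => (P x y)%:E * \sum_(0 <= k < n) iter k (taboo_step D) h y)).
- by move=> n y; rewrite mule_ge0 ?lee_fin// sume_ge0.
- move=> y _; apply: cvgeZl => //.
  exact: is_cvg_nneseries.
- by move=> n; rewrite leeBrDl// -sum_iter_taboo_stepS// sum_le_green.
Qed.

(** Continuity along increasing sets: the supremum of the Green functions of the
    [Dn n] is a supersolution for [D], by Fatou. *)
Lemma green_cvg (Dn : nat -> set S) D h x :
  (forall y, 0 <= h y) -> (forall y, h y \is a fin_num) ->
  (forall n, Dn n `<=` Dn n.+1) -> (forall n, Dn n `<=` D) ->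
  (forall y, D y -> exists n, Dn n y) ->
  green (Dn n) h x @[n --> \oo] --> green D h x.
Proof.
move=> h0 hfin Dincr DnD Dlim.
have Dmono m n : (m <= n)%N -> Dn m `<=` Dn n.
  move=> /subnK <-; elim: (n - m)%N => // k IH.
  by rewrite addSn; exact: subset_trans (Dincr _).
have gmono y : nondecreasing_seq (fun n => green (Dn n) h y).
  by move=> m n mn; apply: le_green => //; exact: Dmono.
have gcvg y := ereal_nondecreasing_cvgn (gmono y).
set l := fun y => ereal_sup (range (fun n => green (Dn n) h y)).
suff -> : green D h x = l x by exact: gcvg.
have l0 y : 0 <= l y.
  apply: le_trans (ereal_sup_ubound _); last by exists 0%N.
  exact: green_ge0.
apply/eqP; rewrite eq_le; apply/andP; split; last first.
  by apply: ge_ereal_sup => _ [n _ <-]; exact: le_green.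
apply: green_le => // y.
rewrite -leeBrDl//.
apply: (@esum_fatou _ _ _
  (fun n w => if w \in Dn n then (P y w)%:E * green (Dn n) h w else 0)).
- by move=> n w; case: ifP => // _; rewrite mule_ge0 ?lee_fin// green_ge0.
- move=> w Dw; have [m Dm] := Dlim w Dw.
  have cv : (P y w)%:E * green (Dn n) h w @[n --> \oo] --> (P y w)%:E * l w.
    by apply: cvgeZl => //; exact: gcvg.
  apply: cvg_trans cv; apply: near_eq_cvg; near=> n.
  rewrite ifT// inE; apply: (Dmono m) => //; near: n; exact: nbhs_infty_ge.
- move=> n; rewrite leeBrDl// -esum_mkcondr.
  rewrite (_ : D `&` Dn n = Dn n); last exact/setIidr.
  apply: le_trans (taboo_step_green_le (Dn n) _ y h0) _.
  by apply: ereal_sup_ubound; exists n.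
Unshelve. all: by end_near. Qed.

End Taboo.

(** * The Markov property *)

Section Fibers.
Local Open Scope ereal_scope.
Context {R : realType} {d : measure_display} {Omega : measurableType d}.

(** An integral is the sum of the integrals over the fibers of a map with values in
    a countable type. *)
Lemma integral_fibers (mu : {measure set Omega -> \bar R}) (T : countType)
    (Y : Omega -> T) (E : set Omega) (f : Omega -> \bar R) :
  measurable E -> (forall t, measurable (Y @^-1` [set t])) ->
  measurable_fun E f -> (forall w, 0 <= f w) ->
  \int[mu]_(w in E) f w =
  \esum_(t in [set: T]) \int[mu]_(w in E `&` Y @^-1` [set t]) f w.
Proof.
move=> mE mY mf f0.
(* The fibers are numbered by the encoding of [T] in [nat]; the codes outside its
   range contribute empty sets. *)
pose F k := E `&` [set w | choice.pickle (Y w) = k].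
have Fpickle t : F (choice.pickle t) = E `&` Y @^-1` [set t].
  rewrite /F; congr (_ `&` _); apply/seteqP; split => w /=; last by move=> ->.
  exact: (pcan_inj choice.pickleK).
have Fnot k : ~ range (@choice.pickle T) k -> F k = set0.
  move=> kN; apply/seteqP; split => // w [_ /= Yk]; apply: kN.
  by exists (Y w).
have mF k : measurable (F k).
  have [[t _ <-]|kN] := pselect (range (@choice.pickle T) k).
    by rewrite Fpickle; exact: measurableI.
  by rewrite Fnot.
have EF : E = \bigcup_k F k.
  apply/seteqP; split => [w Ew|w [k _ []]//].
  by exists (choice.pickle (Y w)).
rewrite [in LHS]EF ge0_integral_bigcup//; last 2 first.
- by rewrite -EF.
- by move=> i j _ _ [w [[_ /= <-] [_ /= <-]]].
rewrite nneseries_esumT; last by move=> k; apply: integral_ge0.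
transitivity (\esum_(k in range (@choice.pickle T)) \int[mu]_(w in F k) f w).
  rewrite [RHS]esum_mkcond; apply: eq_esum => k _.
  case: ifPn => // /negP kN; rewrite Fnot ?integral_set0//.
  by move=> ?; apply: kN; rewrite inE.
rewrite esum_image; first by apply: eq_esum => t _; rewrite Fpickle.
by move=> i j _ _; exact: (pcan_inj choice.pickleK).
Qed.

Lemma integral_cst_on (mu : {measure set Omega -> \bar R}) (C : set Omega)
    (f : Omega -> \bar R) (r : \bar R) :
  measurable C -> (forall w, C w -> f w = r) ->
  \int[mu]_(w in C) f w = r * mu C.
Proof.
move=> mC fr; rewrite -integral_cst//; apply: eq_integral => w.
by rewrite inE => /fr.
Qed.

End Fibers.

Section MarkovChain.
Local Open Scope ereal_scope.
Context {R : realType} {S : countType} {d : measure_display}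
  {Omega : measurableType d} (P : S -> S -> R) (X : nat -> Omega -> S)
  (Pr : S -> probability Omega R).
Context (hX : markov_chain P X Pr).
Implicit Types (D : set S) (h : S -> \bar R) (x y z : S).

Let P0 x y : (0 <= P x y)%R. Proof. by case: hX => -[]. Qed.

Let mX n (B : set S) : measurable (X n @^-1` B). Proof. by case: hX. Qed.

Lemma measurable_fun_chain (E : set Omega) h n :
  measurable_fun E (fun w => h (X n w)).
Proof. by move=> mE B _; apply: measurableI => //; exact: (mX n (h @^-1` B)). Qed.

(** The event that the chain is in [D] at times [1..j]; time 0 is left free. *)
Definition stays D j : set Omega :=
  [set w | forall i, (0 < i <= j)%N -> D (X i w)].

Lemma measurable_stays D j : measurable (stays D j).
Proof.
rewrite (_ : stays D j =
  \bigcap_i (if (0 < i <= j)%N then X i @^-1` D else setT)); last first.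
  apply/seteqP; split => w /= H i.
    by move=> _; case: ifP => // /H.
  by move=> ij; have := H i I; rewrite ij.
by apply: bigcapT_measurable => i; case: ifP => _; [exact: mX | exact: measurableT].
Qed.

Lemma measurable_history (s : nat -> S) j :
  measurable [set w | forall i, (i <= j)%N -> X i w = s i].
Proof.
rewrite (_ : [set w | _] =
  \bigcap_i (if (i <= j)%N then X i @^-1` [set s i] else setT)); last first.
  apply/seteqP; split => w /= H i.
    by move=> _; case: ifP => // /H.
  by move=> ij; have := H i I; rewrite ij.
by apply: bigcapT_measurable => i; case: ifP => _; [exact: mX | exact: measurableT].
Qed.

(** The Markov property for functions: integrate out the last step.  The proof
    conditions on the whole history up to time [j]. *)
Lemma markov_step D h j x : (forall y, 0 <= h y) ->
  \int[Pr x]_(w in stays D j.+1) h (X j.+1 w) =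
  \int[Pr x]_(w in stays D j) taboo_step P D h (X j w).
Proof.
move=> h0.
(* [Y] is the history up to time [j], with values in a countable type; [C t] is the
   event that it equals [t]. *)
pose Y w : {ffun 'I_j.+1 -> S} := [ffun i : 'I_j.+1 => X i w].
pose s (t : {ffun 'I_j.+1 -> S}) i := t (inord i).
pose C t := [set w | forall i, (i <= j)%N -> X i w = s t i].
have YC t : Y @^-1` [set t] = C t.
  apply/seteqP; split => w /=.
    by move=> <- i ij; rewrite /s ffunE inordK.
  move=> Cw; apply/ffunP => i; rewrite ffunE Cw /s ?inord_val//.
  by rewrite -ltnS.
have mC t : measurable (C t) by exact: measurable_history.
have mY t : measurable (Y @^-1` [set t]) by rewrite YC.
rewrite (integral_fibers _ _ Y _ _ _ mY); last 3 first.
- exact: measurable_stays.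
- exact: measurable_fun_chain.
- by move=> w; exact: h0.
rewrite [RHS](integral_fibers _ _ Y _ _ _ mY); last 3 first.
- exact: measurable_stays.
- exact: measurable_fun_chain.
- by move=> w; exact: taboo_step_ge0.
apply: eq_esum => t _; rewrite YC.
(* Histories that leave [D] contribute nothing to either side. *)
have [sD|sND] := pselect (forall i, (0 < i <= j)%N -> D (s t i)); last first.
  rewrite (_ : stays D j `&` _ = set0); last first.
    apply/seteqP; split => // w [/= wD wC]; apply: sND => i /andP[i0 ij].
    by rewrite -wC//; apply: wD; rewrite i0.
  rewrite (_ : stays D j.+1 `&` _ = set0) ?integral_set0//.
  apply/seteqP; split => // w [/= wD wC]; apply: sND => i /andP[i0 ij].
  by rewrite -wC//; apply: wD; rewrite i0 leqW.
have -> : stays D j `&` C t = C t.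
  by apply/setIidr => w wC i /[dup] ij /andP[_ ?]; rewrite wC//; exact: sD.
rewrite [RHS](integral_cst_on _ _ _ (taboo_step P D h (s t j)))//; last first.
  by move=> w wC; rewrite wC.
rewrite (integral_fibers _ _ (X j.+1)); last 4 first.
- by apply: measurableI => //; exact: measurable_stays.
- by move=> y; exact: mX.
- exact: measurable_fun_chain.
- by move=> w; exact: h0.
transitivity (\esum_(y in D) (Pr x (C t) * ((P (s t j) y)%:E * h y))).
  rewrite [RHS]esum_mkcond; apply: eq_esum => y _.
  have [/set_mem Dy|yND] := boolP (y \in D).
    rewrite (_ : _ `&` _ = [set w | C t w /\ X j.+1 w = y]); last first.
      apply/seteqP; split => w /=; first by move=> [[]].
      move=> [wC wy]; split=> //; split => // i /andP[i0].
      rewrite leq_eqVlt => /predU1P[->|ij]; first by rewrite wy.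
      by rewrite wC//; apply: sD; rewrite i0.
    rewrite (integral_cst_on _ _ _ (h y)); last 2 first.
    - by apply: measurableI; [exact: mC|exact: (mX j.+1 [set y])].
    - by move=> w [_ ->].
    rewrite muleA [in RHS]muleC; congr (_ * _).
    by case: hX => _ _ _; exact.
  rewrite (_ : _ `&` _ = set0) ?integral_set0//.
  apply/seteqP; split => // w [[wD _] /= wy]; move/negP: yND; apply.
  by rewrite inE -wy; apply: wD; rewrite leqnn.
have PrC := fineK (fin_num_measure (Pr x) (C t) (mC t)).
rewrite muleC -PrC esumZl ?PrC//; first by rewrite fine_ge0.
by move=> y; rewrite mule_ge0 ?lee_fin.
Qed.

(** The expectation of [h (X_j)] while the chain stays in [D] is [(P_D^j h)(x)]. *)
Lemma integral_stays D h j x : (forall y, 0 <= h y) ->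
  \int[Pr x]_(w in stays D j) h (X j w) = iter j (taboo_step P D) h x.
Proof.
elim: j h => [|j IH] h h0; last first.
  by rewrite markov_step// IH ?iterSr// => y; exact: taboo_step_ge0.
rewrite (integral_fibers _ _ (X 0%N)); last 4 first.
- exact: measurable_stays.
- by move=> y; exact: mX.
- exact: measurable_fun_chain.
- by move=> w; exact: h0.
have stays0 : stays D 0 = setT by apply/seteqP; split => // w _ [].
have E y : \int[Pr x]_(w in stays D 0 `&` X 0%N @^-1` [set y]) h (X 0%N w) =
    h y * Pr x (X 0%N @^-1` [set y]).
  by rewrite stays0 setTI (integral_cst_on _ _ _ (h y)) => [//||w ->//]; exact: mX.
have X0x : Pr x (X 0%N @^-1` [set x]) = 1 by case: hX.
transitivity (\esum_(y in [set x]) (h y * Pr x (X 0%N @^-1` [set y]))).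
  rewrite [RHS]esum_mkcond; apply: eq_esum => y _; rewrite E.
  case: ifPn => [//|/negP yx]; rewrite (_ : Pr x _ = 0) ?mule0//.
  apply/eqP; rewrite eq_le measure_ge0 andbT.
  apply: (@le_trans _ _ (Pr x (~` (X 0%N @^-1` [set x])))).
    apply: le_measure; rewrite ?inE; [exact: mX|exact: measurableC|].
    by move=> w /= wy wx; apply: yx; rewrite inE /= -wy.
  by rewrite probability_setC ?X0x ?subee//; exact: mX.
by rewrite esum_set1 X0x mule1//=; exact: h0.
Qed.

Lemma prob_stays D j x : Pr x (stays D j) = iter j (taboo_step P D) (cst 1) x.
Proof.
rewrite -integral_stays; last by move=> y; rewrite lee_fin.
by rewrite integral_cst ?mul1e//; exact: measurable_stays.
Qed.

(** Irreducibility: a set that contains a state and is closed under transitions of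
    positive probability contains all states. *)
Lemma irreducible_closed (Z : set S) x y : irreducible_chain X Pr ->
  (forall u w, Z u -> (0 < P u w)%R -> Z w) -> Z x -> Z y.
Proof.
move=> hirr Zc Zx; have [n] := hirr x y.
apply: contraPP => Zy; apply/negP; rewrite -leNgt.
have -> : Pr x [set w | X n w = y] =
    iter n (taboo_step P setT) (fun u => (\1_[set y] u)%:E) x.
  rewrite -integral_stays => [|u]; last by rewrite lee_fin.
  rewrite (_ : stays setT n = setT); last by apply/seteqP; split.
  transitivity (Pr x (X n @^-1` [set y] `&` setT)); first by rewrite setIT.
  by rewrite -integral_indic//; exact: (mX n [set y]).
elim: n x Zx => [|n IH] x Zx.
  rewrite /= indicE lee_fin; case: (boolP (x \in _)) => //.
  by rewrite inE /= => xy; rewrite xy in Zx.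
rewrite iterS; rewrite (_ : taboo_step _ _ _ _ = 0)//; apply: esum1 => u _.
have [Pu|] := ltP 0%R (P x u).
  rewrite (_ : iter _ _ _ u = 0) ?mule0//; apply/eqP.
  rewrite eq_le IH//=; last exact: Zc Pu.
  by apply: iter_taboo_step_ge0 => // w; rewrite lee_fin.
move=> Pu; rewrite (_ : P x u = 0%R) ?mul0e//.
by apply/eqP; rewrite eq_le Pu P0.
Qed.

(** The summation range of [cycle_reward], as an event on finitely many steps. *)
Lemma stays_tau z j w : ((j%:R)%:E < tau R X z w) <-> stays [set~ z] j w.
Proof.
split => [jt i /andP[i0 ij] /= Xi|sj].
  move: jt; apply/negP; rewrite -leNgt; apply: (@le_trans _ _ (i%:R)%:E).
    by apply: ereal_inf_lbound; exists i.
  by rewrite lee_fin ler_nat.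
apply: (@lt_le_trans _ _ (j.+1%:R)%:E); first by rewrite lte_fin ltr_nat.
apply/ereal_infP => _ [n [n0 Xn] <-]; rewrite lee_fin ler_nat ltnNge.
by apply/negP => nj; apply: (sj n) Xn; rewrite n0.
Qed.

Lemma cycle_reward_green z (q : S -> R) x : (forall y, (0 <= q y)%R) ->
  cycle_reward X Pr z q x = green P [set~ z] (fun y => (q y)%:E) x.
Proof.
move=> q0; rewrite /cycle_reward /green.
under eq_integral => w _.
  rewrite esum_mkcond -nneseries_esumT; last first.
    by move=> j; case: ifP => // _; rewrite lee_fin.
  over.
rewrite integral_nneseries//; last 2 first.
- move=> n; rewrite (_ : (fun w => _) =
    ((fun w => (q (X n w))%:E) \_ (stays [set~ z] n))); last first.
    apply/funext => w; rewrite patchE; congr (if _ then _ else _).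
    by apply/idP/idP; rewrite !inE => /stays_tau.
  apply/(measurable_restrictT _ _).1; first exact: measurable_stays.
  exact: (measurable_fun_chain _ (fun y => (q y)%:E)).
- by move=> n w _; case: ifP => // _; rewrite lee_fin.
apply: eq_eseriesr => n _; rewrite -integral_stays; last first.
  by move=> y; rewrite lee_fin.
rewrite [RHS]integral_mkcond; apply: eq_integral => w _; rewrite patchE.
congr (if _ then _ else _).
by apply/idP/idP; rewrite !inE => /stays_tau.
Qed.

Lemma recurrent_return z : recurrent_chain X Pr ->
  iter n (taboo_step P [set~ z]) (cst 1) z @[n --> \oo] --> 0.
Proof.
move=> hrec.
(* Never returning to [z] is the decreasing limit of not returning before time [n]. *)
have Cap : \bigcap_n stays [set~ z] n = ~` [set w | tau R X z w < +oo].
  apply/seteqP; split => w /=.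
    move=> sw /ereal_inf_lt[_ [n [n0 Xn] <-] _].
    by apply: (sw n I n) Xn; rewrite n0 leqnn.
  move=> tw n _; apply/stays_tau; apply: (@lt_le_trans _ _ +oo); first exact: ltry.
  by rewrite leNgt; apply/negP.
have mcap : measurable (\bigcap_n stays [set~ z] n).
  by apply: bigcapT_measurable => n; exact: measurable_stays.
have mtau : measurable [set w | tau R X z w < +oo].
  by rewrite -[X in measurable X]setCK -Cap; exact: measurableC.
under eq_fun do rewrite -prob_stays.
rewrite (_ : 0 = Pr z (\bigcap_n stays [set~ z] n)); last first.
  by rewrite Cap probability_setC ?hrec ?subee.
apply: nonincreasing_cvg_mu => //.
- by rewrite (le_lt_trans (probability_le1 _ _)) ?ltry//; exact: measurable_stays.
- by move=> n; exact: measurable_stays.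
- move=> m n mn; apply/subsetPset => w sw i /andP[i0 im].
  by apply: sw; rewrite i0 (leq_trans im).
Qed.

(** From every starting point, the probability of avoiding [z] up to time [n] tends
    to 0. *)
Lemma stays_cvg0 z x : irreducible_chain X Pr -> recurrent_chain X Pr ->
  iter n (taboo_step P [set~ z]) (cst 1) x @[n --> \oo] --> 0.
Proof.
move=> hirr hrec; pose Q := taboo_step P [set~ z].
pose Z : set S := [set y | iter n Q (cst 1) y @[n --> \oo] --> 0].
apply: (@irreducible_closed Z z) => //; last exact: recurrent_return.
move=> u w; rewrite /Z /= => Zu Puw.
have [->|wz] := eqVneq w z; first exact: recurrent_return.
have cst0 y : 0 <= cst 1 y :> \bar R by rewrite lee_fin.
have le n : (P u w)%:E * iter n Q (cst 1) w <= iter n.+1 Q (cst 1) u.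
  rewrite iterS; apply: (@esum_ge1 _ _ _ (fun y => (P u y)%:E * iter n Q (cst 1) y)).
    by move=> y; rewrite mule_ge0 ?lee_fin//; exact: iter_taboo_step_ge0.
  exact/eqP.
apply: (@squeeze_cvge _ _ _ _ (cst 0) _
  (fun n => (P u w)^-1%:E * iter n.+1 Q (cst 1) u)).
- apply: nearW => n; rewrite iter_taboo_step_ge0//=.
  by rewrite lee_pdivlMl.
- exact: cvg_cst.
- rewrite -[X in _ --> X](mule0 (P u w)^-1%:E); apply: cvgeZl => //.
  by move: Zu; rewrite -cvg_shiftS.
Qed.

End MarkovChain.

(** * Recurrence and drift *)

(** Finitely many eventual properties hold simultaneously. *)
Lemma near_all_seq {I : Type} {F : set_system I} {FF : Filter F} {T : eqType}
    (s : seq T) (Q : T -> I -> Prop) :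
  (forall y, y \in s -> \forall n \near F, Q y n) ->
  \forall n \near F, forall y, y \in s -> Q y n.
Proof.
elim: s => [|a s IH] H; first exact: nearW.
have Ha := H a (mem_head _ _).
have Hs : \forall n \near F, forall y, y \in s -> Q y n.
  by apply: IH => y ys; apply: H; rewrite inE ys orbT.
near=> n => y; rewrite inE => /predU1P[->|]; first by near: n.
by move: y; near: n.
Unshelve. all: by end_near. Qed.

Section Recurrent.
Local Open Scope ereal_scope.
Context {R : realType} {S : countType} (P : S -> S -> R) (z : S).
Context (P_stoch : stochastic P).
Let Q := taboo_step P [set~ z].
Context (Q_decay : forall x, iter n Q (cst 1) x @[n --> \oo] --> 0).
Implicit Types (D : set S) (h u : S -> \bar R) (x y : S).

Let P0 x y : (0 <= P x y)%R. Proof. by case: P_stoch. Qed.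

Let cst1_ge0 y : 0 <= cst 1 y :> \bar R. Proof. by rewrite lee_fin. Qed.

Let itQ_ge0 n y : 0 <= iter n Q (cst 1) y.
Proof. exact: iter_taboo_step_ge0. Qed.

Lemma step_hit_or_avoid x : (P x z)%:E + Q (cst 1) x = 1.
Proof.
rewrite -[RHS](P_stoch.2 x) (esumID [set z])//; last by move=> y _; rewrite lee_fin.
rewrite !setTI esum_set1 ?lee_fin//; congr (_ + _).
by apply: eq_esum => y _; rewrite mule1.
Qed.

Lemma iter_avoid_le1 n x : iter n Q (cst 1) x <= 1.
Proof.
elim: n x => [//|n IH] x; rewrite iterS -[leRHS](step_hit_or_avoid x).
apply: (@le_trans _ _ (Q (cst 1) x)); last by rewrite leeDr// lee_fin.
by apply: le_taboo_step; [|exact: cst1_ge0|exact: subset_refl|move=> y _; exact: IH].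
Qed.

(** Up to time [n], the chain either hits [z] or avoids it. *)
Lemma sum_hit_avoid n x :
  \sum_(0 <= k < n) iter k Q (fun y => (P y z)%:E) x + iter n Q (cst 1) x = 1.
Proof.
have Pz0 y : 0 <= (P y z)%:E by rewrite lee_fin.
elim: n x => [|n IH] x; first by rewrite big_nil add0e.
rewrite /Q sum_iter_taboo_stepS// iterS -addeA -taboo_stepD//; last first.
  by move=> y; apply: sume_ge0 => k _; exact: iter_taboo_step_ge0.
rewrite -[RHS](step_hit_or_avoid x); congr (_ + _).
by apply: eq_esum => y _; rewrite IH.
Qed.

(** The chain hits [z] with probability 1. *)
Lemma green_hit x : green P [set~ z] (fun y => (P y z)%:E) x = 1.
Proof.
have Pz0 y : 0 <= (P y z)%:E by rewrite lee_fin.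
apply: cvg_lim => //.
rewrite (_ : (fun n => _) = fun n => 1 - iter n Q (cst 1) x); last first.
  apply/funext => n; rewrite -[X in X - _](sum_hit_avoid n x) addeK//.
  rewrite ge0_fin_numE//; exact: le_lt_trans (iter_avoid_le1 _ _) (ltry _).
rewrite -[X in _ --> X]sube0.
by apply: cvgeB => //; exact: cvg_cst.
Qed.

Lemma subset_decay D x : D `<=` [set~ z] ->
  iter n (taboo_step P D) (cst 1) x @[n --> \oo] --> 0.
Proof.
move=> DD; apply: (squeeze_cvge _ (cvg_cst _) (Q_decay x)).
apply: nearW => n; apply/andP; split; first exact: iter_taboo_step_ge0.
exact: le_iter_taboo_step.
Qed.

(** The Foster-Lyapunov bound: under the drift condition the expected reward before the
    return to [z] is finite. *)
Lemma green_drift_fin (K : {fset S}) (v q : S -> R) (c : R) x :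
  (forall y, 0 <= v y)%R -> (forall y, 0 <= q y)%R -> drift P K v q c ->
  green P [set~ z] (fun y => (q y)%:E) x \is a fin_num.
Proof.
move=> v0 q0 dr.
have [m mK] : exists m, forall y, y \in (K : seq S) -> iter m Q (cst 1) y <= (2^-1)%:E.
  have : \forall n \near \oo, forall y, y \in (K : seq S) ->
      iter n Q (cst 1) y <= (2^-1)%:E.
    apply: (near_all_seq _ (fun y n => iter n Q (cst 1) y <= (2^-1)%:E)) => y _.
    have half : (0 < 2^-1 :> R)%R by rewrite invr_gt0.
    have Hn := cvgr_le (0 : R)%R (fine_cvg (Q_decay y)) _ half.
    near=> n; have : (fine (iter n Q (cst 1%E) y) <= 2^-1)%R by near: n; exact: Hn.
    rewrite -lee_fin fineK//.
    by rewrite ge0_fin_numE// (le_lt_trans (iter_avoid_le1 _ _)) ?ltry.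
  by move=> [m _ mP]; exists m; exact: (mP m (leqnn m)).
(* [s - Q s = 1 - Q^m 1] is nonnegative, and at least 1/2 on [K]; this absorbs the
   term [c] of the drift condition. *)
pose s y : \bar R := \sum_(0 <= k < m) iter k Q (cst 1) y.
have s0 y : 0 <= s y by apply: sume_ge0.
have sfin y : s y \is a fin_num.
  rewrite ge0_fin_numE//; apply: (@le_lt_trans _ _ (\sum_(0 <= k < m) 1)).
    by apply: lee_sum => k _; exact: iter_avoid_le1.
  by rewrite sumEFin ltry.
have Qs y : 1 + Q s y = s y + iter m Q (cst 1) y.
  rewrite -(sum_iter_taboo_stepS P P0 _ (cst 1))//.
  by rewrite big_nat_recr.
have Qm_fin y : iter m Q (cst 1) y \is a fin_num.
  by rewrite ge0_fin_numE// (le_lt_trans (iter_avoid_le1 _ _)) ?ltry.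
have Qs_fin y : Q s y \is a fin_num.
  have : 1 + Q s y \is a fin_num by rewrite Qs fin_numD sfin Qm_fin.
  by rewrite fin_numD => /andP[].
pose C : R := (2 * `|c|)%R.
have C0 : (0 <= C)%R by rewrite /C mulr_ge0.
pose u y := (v y)%:E + C%:E * s y.
have u0 y : 0 <= u y by rewrite adde_ge0 ?lee_fin// mule_ge0 ?lee_fin.
have vE0 y : 0 <= (v y)%:E by rewrite lee_fin.
have le_u : green P [set~ z] (fun y => (q y)%:E) x <= u x.
  apply: green_le => // y.
  rewrite taboo_stepD//; last by move=> w; rewrite mule_ge0 ?lee_fin.
  rewrite taboo_stepZ//.
  have Qv : Q (fun w => (v w)%:E) y <= (v y - q y + c * (y \in K)%:R)%:E.
    apply: le_trans (dr y).
    rewrite (_ : esum _ _ = taboo_step P setT (fun w => (v w)%:E) y)//.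
    exact: le_taboo_step.
  apply: (@le_trans _ _ ((q y)%:E +
      ((v y - q y + c * (y \in K)%:R)%:E + C%:E * Q s y))).
    by rewrite leeD2l// leeD2r.
  have := Qs y; have := mK y; have := iter_avoid_le1 m y.
  rewrite /u -(fineK (sfin y)) -(fineK (Qs_fin y)) -(fineK (Qm_fin y)).
  move: (fine (s y)) (fine (Q s y)) (fine (iter m Q (cst 1) y)) => a b e.
  rewrite -!EFinM -!EFinD !lee_fin => e1 eK [abe].
  have cn : (c <= `|c|)%R by exact: ler_norm.
  have -> : b = (a + e - 1)%R by lra.
  have Ne : (0 <= `|c| * (1 - e))%R by rewrite mulr_ge0// subr_ge0.
  rewrite /C; case: (boolP (y \in K)) eK => yK eK; last by rewrite mulr0; lra.
  have Ne' : (0 <= `|c| * (2^-1 - e))%R by rewrite mulr_ge0// subr_ge0 eK.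
  by rewrite mulr1; lra.
rewrite ge0_fin_numE.
  by apply: le_lt_trans le_u _; rewrite /u -(fineK (sfin x)) -EFinM -EFinD ltry.
by apply: green_ge0 => // y; rewrite lee_fin.
Unshelve. all: by end_near. Qed.

End Recurrent.

(** * Finite linear systems *)

Section FiniteStep.
Context {R : realType} {S : countType} (P : S -> S -> R).
Context (P0 : forall x y, 0 <= P x y).
Implicit Types (D : {fset S}) (h u : S -> R) (x y : S).

(** The real-valued product [(M u)(x)] restricted to the columns in the finite set
    [D]. *)
Definition fin_step D u x : R := \sum_(y <- D) P x y * u y.

Lemma eq_fin_step D u w x :
  (forall y, y \in D -> u y = w y) -> fin_step D u x = fin_step D w x.
Proof.
move=> uw; rewrite /fin_step big_seq [RHS]big_seq.
by apply: eq_bigr => y yD; rewrite uw.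
Qed.

Lemma fin_stepD D u w x :
  fin_step D (fun y => u y + w y) x = fin_step D u x + fin_step D w x.
Proof. by rewrite /fin_step -big_split; apply: eq_bigr => y _; rewrite mulrDr. Qed.

Lemma iter_fin_stepE D h n x : (forall y, 0 <= h y) ->
  (iter n (fin_step D) h x)%:E =
  iter n (taboo_step P [set` D]) (fun y => (h y)%:E) x.
Proof.
move=> h0; elim: n x => [//|n IH] x.
rewrite [in RHS]iterS /taboo_step esum_fset_seq; last first.
  by move=> y; rewrite mule_ge0 ?lee_fin// iter_taboo_step_ge0.
rewrite iterS /fin_step -sumEFin; apply: eq_bigr => y _.
by rewrite EFinM IH.
Qed.

Section Decay.
Context (D : {fset S}).
Context (D_decay : forall x,
  iter n (taboo_step P [set` D]) (cst 1%E) x @[n --> \oo] --> 0%E).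

(** If [P_D^n 1] tends to 0, then so does [P_D^n u] for every [u]: on the finite set
    [D], [|u|] is dominated by a constant. *)
Lemma fin_step_decay u x : x \in D ->
  iter n (fin_step D) u x @[n --> \oo] --> (0 : R).
Proof.
move=> xD; pose M := \sum_(y <- D) `|u y|.
have M0 : 0 <= M by apply: sumr_ge0.
have uM n y : y \in D ->
    `|iter n (fin_step D) u y| <= M * iter n (fin_step D) (cst 1) y.
  elim: n y => [|n IH] y yD.
    by rewrite /= mulr1 /M (big_fsetD1 y)//= lerDl sumr_ge0.
  rewrite !iterS; apply: le_trans (ler_norm_sum _ _ _) _.
  rewrite /fin_step mulr_sumr big_seq [leRHS]big_seq; apply: ler_sum => w wD.
  by rewrite normrM ger0_norm// mulrCA ler_wpM2l// IH.
have cv : iter n (fin_step D) (cst 1) x @[n --> \oo] --> (0 : R).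
  rewrite (_ : (fun n => _) =
    fine \o (fun n => iter n (taboo_step P [set` D]) (cst 1%E) x)).
    exact: fine_cvg.
  by apply/funext => n /=; rewrite -(iter_fin_stepE D (cst 1)).
apply/norm_cvg0P.
apply: (@squeeze_cvgr _ _ _ _ (cst 0) (fun n => M * iter n (fin_step D) (cst 1) x)).
- by apply: nearW => n; rewrite normr_ge0 uM.
- exact: cvg_cst.
- by rewrite -[X in _ --> X](mulr0 M); exact: cvgM (cvg_cst _) cv.
Qed.

Section Solution.
Context (h u : S -> R).
Context (u_sol : forall x, x \in D -> u x = h x + fin_step D u x).

Lemma solution_partial_sums n x : x \in D ->
  u x = \sum_(0 <= k < n) iter k (fin_step D) h x + iter n (fin_step D) u x.
Proof.
have IT k y : y \in D -> iter k (fin_step D) u y =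
    iter k (fin_step D) h y + iter k.+1 (fin_step D) u y.
  elim: k y => [|k IH] y yD; first by rewrite {1}/iter u_sol.
  change (fin_step D (iter k (fin_step D) u) y =
    fin_step D (iter k (fin_step D) h) y + fin_step D (iter k.+1 (fin_step D) u) y).
  by rewrite -fin_stepD; apply: eq_fin_step => w wD; exact: IH.
move=> xD; elim: n => [|n IH]; first by rewrite big_nil add0r.
by rewrite big_nat_recr//= -addrA -iterS -IT.
Qed.

Lemma solution_cvg x : x \in D ->
  \sum_(0 <= k < n) iter k (fin_step D) h x @[n --> \oo] --> u x.
Proof.
move=> xD.
rewrite (_ : (fun n => _) = fun n => u x - iter n (fin_step D) u x); last first.
  by apply/funext => n; rewrite [X in X - _](solution_partial_sums n x xD) addrK.
rewrite -[X in _ --> X]subr0; apply: cvgB; first exact: cvg_cst.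
exact: fin_step_decay.
Qed.

(** The solution of [u = h + P_D u] with a nonnegative reward is the Green
    function. *)
Lemma solution_green x : (forall y, 0 <= h y) -> x \in D ->
  (u x)%:E = green P [set` D] (fun y => (h y)%:E) x.
Proof.
move=> h0 xD; apply/esym/cvg_lim => //.
rewrite (_ : (fun n => _) =
  EFin \o (fun n => \sum_(0 <= k < n) iter k (fin_step D) h x)); last first.
  apply/funext => n /=; rewrite -sumEFin; apply: eq_bigr => k _.
  by rewrite iter_fin_stepE.
by apply: cvg_EFin; [exact: nearW | exact: solution_cvg].
Qed.

End Solution.

Lemma solution_ge0 h u x : (forall y, 0 <= h y) ->
  (forall y, y \in D -> u y = h y + fin_step D u y) -> x \in D -> 0 <= u x.
Proof.
move=> h0 hu xD; rewrite -lee_fin (solution_green h u hu)//.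
by apply: green_ge0 => // y; rewrite lee_fin.
Qed.

Lemma fin_step_fixed0 u :
  (forall x, x \in D -> u x = fin_step D u x) -> forall x, x \in D -> u x = 0.
Proof.
move=> hu x xD.
have sol y : y \in D -> u y = (fun=> 0) y + fin_step D u y.
  by move=> /hu; rewrite add0r.
have cv := solution_cvg (fun=> 0) u sol x xD.
have : (fun n => \sum_(0 <= k < n) iter k (fin_step D) (fun=> 0) x) = cst 0.
  apply/funext => n; apply: big1 => k _; elim: k x {xD cv} => [//|k IH] x.
  by rewrite iterS /fin_step big1// => y _; rewrite IH mulr0.
move=> E; move: cv; rewrite E => cv.
by rewrite -(cvg_lim (@Rhausdorff R) cv) lim_cst//; exact: Rhausdorff.
Qed.

End Decay.
End FiniteStep.

(** * The truncated kernel by block elimination *)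

Section InverseBlock.
Context {R : realType} {S : countType}.
Implicit Types (D : {fset S}) (M : S -> S -> R) (u h : S -> R) (x : S).

Lemma sum_enum_val D (F : S -> R) :
  \sum_(y <- D) F y = \sum_(i < #|{: D}|) F (val (enum_val i)).
Proof. by rewrite big_seq_fsetE/= big_enum_val. Qed.

(** If [u = M u] on [D] forces [u = 0] there, then [inv_one_sub D M] is the inverse
    of [I - M], so it yields the solution of [u = h + M u] on [D]. *)
Lemma inv_one_subP D M h x :
  (forall u, (forall y, y \in D -> u y = fin_step M D u y) ->
     forall y, y \in D -> u y = 0) ->
  x \in D ->
  fin_step (inv_one_sub D M) D h x =
  h x + fin_step M D (fin_step (inv_one_sub D M) D h) x.
Proof.
move=> inj xD.
pose e (i : 'I_#|{: D}|) : S := val (enum_val i).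
pose B : 'M[R]_#|{: D}| :=
  1%:M - \matrix_(a < #|{: D}|, b < #|{: D}|) M (val (enum_val a)) (val (enum_val b)).
have eD y (yD : y \in D) : exists i, y = e i.
  by exists (enum_rank [` yD]%fset); rewrite /e enum_rankK.
have insub_e i : insub (e i) = Some (enum_val i) :> option D by rewrite valK.
have invE i j : inv_one_sub D M (e i) (e j) = invmx B i j.
  by rewrite /inv_one_sub !insub_e !enum_valK.
have mulB (v : 'cV[R]_#|{: D}|) i :
    (B *m v) i 0 = v i 0 - \sum_j M (e i) (e j) * v j 0.
  rewrite mulmxBl mul1mx mxE; congr (_ + _); rewrite !mxE; congr (- _).
  by apply: eq_bigr => j _; rewrite mxE.
(* A row vector in the left kernel of the transpose is a function [u] on [D] with
   [u = M u]. *)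
have unitB : B \in unitmx.
  rewrite -unitmx_tr -row_free_unit; apply: inj_row_free => v vB.
  have Bv : B *m v^T = 0 by rewrite -[B]trmxK -trmx_mul vB trmx0.
  pose u y := if insub y is Some i then v 0 (enum_rank (i : D)) else 0.
  have ue i : u (e i) = v 0 i by rewrite /u insub_e enum_valK.
  have u0 y : y \in D -> u y = 0.
    apply: inj => {}y /eD[i ->]; rewrite /fin_step sum_enum_val ue.
    have := mulB v^T i; rewrite Bv !mxE => /esym/eqP; rewrite subr_eq0 => /eqP ->.
    by apply: eq_bigr => j _; rewrite mxE -ue.
  by apply/rowP => i; rewrite mxE -ue u0// /e fsvalP.
pose H : 'cV[R]_#|{: D}| := \col_i h (e i).
have UE i : fin_step (inv_one_sub D M) D h (e i) = (invmx B *m H) i 0.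
  rewrite /fin_step sum_enum_val mxE; apply: eq_bigr => j _.
  by rewrite -/(e j) invE mxE.
have [i ->] := eD x xD.
have ME : fin_step M D (fin_step (inv_one_sub D M) D h) (e i) =
    \sum_j M (e i) (e j) * (invmx B *m H) j 0.
  rewrite {1}/fin_step sum_enum_val; apply: eq_bigr => j _.
  by rewrite -UE.
by have := mulB (invmx B *m H) i; rewrite mulKVmx// ME UE mxE => ->; rewrite subrK.
Qed.

End InverseBlock.

Section KappaSystem.
Context {R : realType} {S : countType} (P : S -> S -> R) (K A : {fset S}) (z : S).
Context (zK : z \in K).
Context (KA : {subset K <= A}).
Let A' := Atrunc K A.
Let Kz := Ktilde K z.
Let B := (A `\ z)%fset.
Context (inj_A' : forall u : S -> R,
  (forall x, x \in A' -> u x = fin_step P A' u x) -> forall x, x \in A' -> u x = 0).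
Context (inj_B : forall u : S -> R,
  (forall x, x \in B -> u x = fin_step P B u x) -> forall x, x \in B -> u x = 0).
Implicit Types (h u : S -> R) (x y : S).

Let inv22 h x := invP22_app P K A h x.

(** [(I - P_22)^{-1} h] solves [u = h + P_22 u] on [A']. *)
Lemma invP22P h x : x \in A' -> inv22 h x = h x + fin_step P A' (inv22 h) x.
Proof. exact: inv_one_subP. Qed.

Lemma invP22_unique h u :
  (forall x, x \in A' -> u x = h x + fin_step P A' u x) ->
  forall x, x \in A' -> u x = inv22 h x.
Proof.
move=> hu x xA; apply/eqP; rewrite -subr_eq0; apply/eqP.
apply: (inj_A' (fun y => u y - inv22 h y)) x xA => x xA.
rewrite hu// invP22P// opprD addrACA subrr add0r /fin_step -sumrB.
by apply: eq_bigr => y _; rewrite mulrBr.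
Qed.

Lemma fin_step_sum (M : S -> S -> R) D (s : seq S) (f : S -> S -> R) (a : S -> R) x :
  fin_step M D (fun w => \sum_(y <- s) f w y * a y) x =
  \sum_(y <- s) fin_step M D (fun w => f w y) x * a y.
Proof.
rewrite /fin_step.
under eq_bigr do rewrite mulr_sumr.
rewrite exchange_big/=; apply: eq_bigr => y _.
by rewrite mulr_suml; apply: eq_bigr => w _; rewrite mulrA.
Qed.

(** [B = A - {z}] is the disjoint union of [K - {z}] and [A']. *)
Lemma sum_B (F : S -> R) : \sum_(y <- B) F y = \sum_(y <- Kz) F y + \sum_(y <- A') F y.
Proof.
rewrite (big_fsetID _ (mem K)); congr (_ + _); apply: eq_fbigl => y; rewrite !inE/=.
  by rewrite -andbA; case: eqP => //= _; have [/KA->|] := boolP (y \in K); rewrite ?andbF.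
by rewrite andbC; have [->|//] := eqVneq y z; rewrite zK.
Qed.

(** [A] is the disjoint union of [K] and [A']. *)
Lemma sum_A (F : S -> R) : \sum_(y <- A) F y = \sum_(y <- K) F y + \sum_(y <- A') F y.
Proof.
rewrite (big_fsetID _ (mem K)); congr (_ + _); apply: eq_fbigl => y; rewrite !inE/=.
  by have [/KA->|] := boolP (y \in K); rewrite ?andbF.
by rewrite andbC.
Qed.

(** Block elimination: a solution [a] of the system reduced to [K - {z}], extended
    to [A'] by back substitution, solves the full system on [B]. *)
Lemma block_extension h a :
  (forall x, x \in Kz -> a x = kfun P K h A x + fin_step (Gmx P K A) Kz a x) ->
  let u x := if x \in K then a x
    else inv22 h x + \sum_(y <- Kz) invP22_P21 P K A x y * a y in
  forall x, x \in B -> u x = h x + fin_step P B u x.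
Proof.
move=> ha u.
have uK x : x \in Kz -> u x = a x by rewrite !inE /u => /andP[_ ->].
pose g w := h w + fin_step P Kz a w.
have uA x : x \in A' -> u x = inv22 g x.
  rewrite !inE /u => /andP[/negbTE -> _]; rewrite /inv22 /invP22_app.
  rewrite -[RHS]/(fin_step (invP22 P K A) A' g x) /g fin_stepD; congr (_ + _).
  rewrite -(fin_step_sum (invP22 P K A) A' Kz P a x).
  by [].
have stepA x : fin_step P A' u x = fin_step P A' (inv22 g) x.
  by apply: eq_fin_step => y; exact: uA.
have stepB x : fin_step P B u x = fin_step P Kz a x + fin_step P A' (inv22 g) x.
  rewrite -stepA /fin_step sum_B; congr (_ + _).
  by rewrite big_seq [RHS]big_seq; apply: eq_bigr => y yK; rewrite uK.
move=> x xB; rewrite stepB.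
have [xK|xK] := boolP (x \in K); last first.
  have xA : x \in A' by move: xB; rewrite !inE xK => /andP[_ ->].
  by rewrite uA// invP22P// addrA.
have xKz : x \in Kz by move: xB; rewrite !inE xK => /andP[->].
rewrite uK// ha// /kfun xK -addrA; congr (_ + _).
rewrite /Gmx {1}/fin_step.
under eq_bigr do rewrite mulrDl.
rewrite big_split/= addrCA; congr (_ + _).
rewrite -[X in X + _]/(fin_step P A' (inv22 h) x).
rewrite -(fin_step_sum P A' Kz (invP22_P21 P K A) a x) -fin_stepD.
apply: eq_fin_step => w wA.
rewrite /inv22 -[RHS]/(fin_step (invP22 P K A) A' g w) /g fin_stepD; congr (_ + _).
by rewrite -(fin_step_sum (invP22 P K A) A' Kz P a w).
Qed.

Lemma inj_G u : (forall x, x \in Kz -> u x = fin_step (Gmx P K A) Kz u x) ->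
  forall x, x \in Kz -> u x = 0.
Proof.
move=> hu x xKz.
have inv0 y : inv22 (fun=> 0) y = 0.
  by rewrite /inv22 /invP22_app big1// => w _; rewrite mulr0.
have H y : y \in Kz ->
    u y = kfun P K (fun=> 0) A y + fin_step (Gmx P K A) Kz u y.
  move=> yK; rewrite {1}hu// /kfun [invP22_app _ _ _ _ _]inv0 add0r.
  rewrite /P12_app big1 ?if_same ?add0r// => w _.
  by rewrite [invP22_app _ _ _ _ _]inv0 mulr0.
have xB : x \in B by move: xKz; rewrite !inE => /andP[-> /KA].
have xK : x \in K by move: xKz; rewrite !inE => /andP[].
have E := block_extension _ u H.
have /= := inj_B _ (fun y yB => etrans (E y yB) (add0r _)) x xB.
by rewrite xK.
Qed.

Lemma kappa_loP h x : x \in B ->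
  kappa_lo P K z h A x = h x + fin_step P B (kappa_lo P K z h A) x.
Proof.
move=> xB.
have -> : kappa_lo P K z h A = fun x => if x \in K then kappa_lo_K P K z h A x
    else inv22 h x + \sum_(y <- Kz) invP22_P21 P K A x y * kappa_lo_K P K z h A y.
  by apply/funext => y; rewrite /kappa_lo /kfun; case: (y \in K).
apply: block_extension => // y yK.
exact: (inv_one_subP Kz (Gmx P K A) (kfun P K h A) y inj_G yK).
Qed.

Lemma kappa_lo_unique h u :
  (forall x, x \in B -> u x = h x + fin_step P B u x) ->
  forall x, x \in B -> kappa_lo P K z h A x = u x.
Proof.
move=> hu x xB; apply/eqP; rewrite -subr_eq0; apply/eqP.
apply: (inj_B (fun y => kappa_lo P K z h A y - u y)) x xB => x xB.
rewrite hu// kappa_loP// opprD addrACA subrr add0r /fin_step -sumrB.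
by apply: eq_bigr => y _; rewrite mulrBr.
Qed.

(** The one-step probability of leaving [A]. *)
Definition exit_prob x : R := 1 - \sum_(y <- A) P x y.

Lemma xi_compl x : x \in A' ->
  inv22 exit_prob x = 1 - \sum_(y <- K) invP22_P21 P K A x y.
Proof.
move=> xA; pose g w := exit_prob w + \sum_(y <- K) P w y * 1.
have one : 1 = inv22 g x.
  apply: (invP22_unique g (fun=> 1)) x xA => x xA.
  have E (D : {fset S}) : \sum_(y <- D) P x y * 1 = \sum_(y <- D) P x y.
    by apply: eq_bigr => y _; rewrite mulr1.
  by rewrite /g /exit_prob /fin_step sum_A !E; ring.
rewrite {1}one /inv22 -[invP22_app _ _ _ g x]/(fin_step (invP22 P K A) A' g x).
rewrite /g fin_stepD (fin_step_sum (invP22 P K A) A' K P (fun=> 1) x).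
rewrite (eq_bigr (invP22_P21 P K A x)) ?addrK// => y _.
by rewrite mulr1.
Qed.

(** [xi] is the function [kfun] of the reward [exit_prob]. *)
Lemma xi_kfun x : x \in A -> xi P K A x = kfun P K exit_prob A x.
Proof.
move=> xA; rewrite /xi /kfun; case: ifPn => xK; last first.
  by rewrite -xi_compl// !inE xK xA.
rewrite (_ : P12_app _ _ _ _ _ =
  fin_step P A' (fun w => 1 - \sum_(y <- K) invP22_P21 P K A w y) x); last first.
  by apply: eq_fin_step => w wA; exact: xi_compl.
rewrite /fin_step.
under [X in _ = _ + X]eq_bigr do rewrite mulrBr mulr1.
have E : \sum_(w <- A') P x w * (\sum_(y <- K) invP22_P21 P K A w y) =
    \sum_(y <- K) P12_app P K A (invP22_P21 P K A ^~ y) x.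
  by under eq_bigr do rewrite mulr_sumr; rewrite exchange_big.
by rewrite sumrB E /exit_prob sum_A /Gmx big_split/=; ring.
Qed.

End KappaSystem.

(** * Truncation errors *)

Section TruncatedChain.
Context {R : realType} {S : countType} (P : S -> S -> R) (K A : {fset S}) (z : S).
Context (P_stoch : stochastic P).
Context (Q_decay : forall x,
  iter n (taboo_step P [set~ z]) (cst 1%E) x @[n --> \oo] --> 0%E).
Context (zK : z \in K).
Context (KA : {subset K <= A}).
Let A' := Atrunc K A.
Let Kz := Ktilde K z.
Let B := (A `\ z)%fset.
Implicit Types (h u q v : S -> R) (x y : S).

Let P0 x y : 0 <= P x y. Proof. by case: P_stoch. Qed.

Let decay_B x : iter n (taboo_step P [set` B]) (cst 1%E) x @[n --> \oo] --> 0%E.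
Proof.
apply: (subset_decay P z) => // y /=; rewrite !inE => /andP[yz _].
exact/eqP.
Qed.

Let decay_A' x : iter n (taboo_step P [set` A']) (cst 1%E) x @[n --> \oo] --> 0%E.
Proof.
apply: (subset_decay P z) => // y /=; rewrite !inE => /andP[yK _] yz.
by rewrite yz zK in yK.
Qed.

Let inj_A' := fin_step_fixed0 P P0 A' decay_A'.
Let inj_B := fin_step_fixed0 P P0 B decay_B.

Let loP h x := kappa_loP P K A z zK KA inj_A' inj_B h x.
Let lo_unique h u := kappa_lo_unique P K A z zK KA inj_A' inj_B h u.

(** [kappa_lo] is the expected reward before leaving [B = A - {z}]. *)
Lemma kappa_lo_green h x : (forall y, 0 <= h y) -> x \in B ->
  (kappa_lo P K z h A x)%:E = green P [set` B] (fun y => (h y)%:E) x.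
Proof.
by move=> h0 xB; apply: (solution_green P P0 B decay_B) => // y; exact: loP.
Qed.

Lemma kappa_lo_ge0 h x : (forall y, 0 <= h y) -> x \in B ->
  0 <= kappa_lo P K z h A x.
Proof.
move=> h0 xB; rewrite -lee_fin kappa_lo_green//.
by apply: green_ge0 => // y; rewrite lee_fin.
Qed.

Lemma kappa_loD h u x : x \in B -> kappa_lo P K z (fun y => h y + u y) A x =
  kappa_lo P K z h A x + kappa_lo P K z u A x.
Proof.
move=> xB.
apply: (lo_unique _ (fun y => kappa_lo P K z h A y + kappa_lo P K z u A y)) => //.
by move=> y yB; rewrite fin_stepD {1}loP// {1}[kappa_lo _ _ _ u _ _]loP//; ring.
Qed.

Lemma invP22_app_ge0 h x : (forall y, 0 <= h y) -> x \in A' ->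
  0 <= invP22_app P K A h x.
Proof.
move=> h0 xA; apply: (solution_ge0 P P0 A' decay_A' h) => // y yA.
exact: (invP22P P K A inj_A').
Qed.

Lemma exit_prob_ge0 x : 0 <= exit_prob P A x.
Proof.
rewrite subr_ge0 -lee_fin -(P_stoch.2 x) -sumEFin -esum_fset_seq; last first.
  by move=> y; rewrite lee_fin.
rewrite esum_mkcond; apply: le_esum => y _.
by case: ifP => // _; rewrite lee_fin.
Qed.

(** Since [B] is left almost surely, the chain leaves [A] before hitting [z], or it
    hits [z] first. *)
Lemma kappa_lo_exit x : x \in B ->
  kappa_lo P K z (exit_prob P A) A x = 1 - kappa_lo P K z (P ^~ z) A x.
Proof.
apply: (lo_unique _ (fun y => 1 - kappa_lo P K z (P ^~ z) A y)) => y yB.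
rewrite {1}loP// /exit_prob (big_fsetD1 z) ?KA//=.
have -> : fin_step P B (fun w => 1 - kappa_lo P K z (P^~ z) A w) y =
    \sum_(w <- B) P y w - fin_step P B (kappa_lo P K z (P^~ z) A) y.
  by rewrite /fin_step -sumrB; apply: eq_bigr => w _; rewrite mulrBr mulr1.
by rewrite -/B; ring.
Qed.

Lemma invG_app_xi x : x \in K ->
  invG_app P K z A (xi P K A) x = kappa_lo P K z (exit_prob P A) A x.
Proof.
move=> xK; rewrite /kappa_lo xK; apply: eq_fin_step => y.
by rewrite !inE => /andP[_ /KA yA]; rewrite (xi_kfun P K A KA inj_A').
Qed.

(** The same for [A']: leave [A] before reaching [K], or reach [K - {z}] and leave
    [A] from there before hitting [z]. *)
Lemma kappa_lo_exitE x : x \in A' -> kappa_lo P K z (exit_prob P A) A x =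
  xi P K A x + \sum_(y <- Kz) invP22_P21 P K A x y * invG_app P K z A (xi P K A) y.
Proof.
move=> xA; have xK : x \notin K by move: xA; rewrite !inE => /andP[].
have {}xA : x \in A by move: xA; rewrite !inE => /andP[].
rewrite /kappa_lo (negbTE xK) (xi_kfun P K A KA inj_A')//; congr (_ + _).
apply: eq_fin_step => y; rewrite !inE => /andP[_ yK].
by rewrite invG_app_xi// /kappa_lo yK.
Qed.

Lemma xi_bounds x : x \in A' ->
  0 <= xi P K A x <= kappa_lo P K z (exit_prob P A) A x.
Proof.
move=> xA'; have xK : x \notin K by move: xA'; rewrite !inE => /andP[].
have xA : x \in A by move: xA'; rewrite !inE => /andP[].
apply/andP; split.
  rewrite (xi_kfun P K A KA inj_A')// /kfun (negbTE xK).
  by apply: invP22_app_ge0 => //; exact: exit_prob_ge0.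
rewrite kappa_lo_exitE// lerDl big_seq; apply: sumr_ge0 => y.
rewrite !inE => /andP[yz yK]; rewrite invG_app_xi// mulr_ge0//.
  exact: invP22_app_ge0.
by apply: kappa_lo_ge0; [exact: exit_prob_ge0|rewrite !inE yz KA].
Qed.

Section Overshoot.
Context (v q : S -> R) (c : R).
Context (v0 : forall x, 0 <= v x).
Context (dr : drift P K v q c).

(** The drift condition makes the sum that defines [Pout] finite, so [fine] loses
    nothing. *)
Lemma PoutE x : (Pout P v A x)%:E =
  taboo_step P [set y | y \notin A] (fun y => (v y)%:E) x.
Proof.
rewrite /Pout fineK//.
rewrite ge0_fin_numE; last by apply: esum_ge0 => y _; rewrite lee_fin mulr_ge0.
apply: le_lt_trans (ltry (v x - q x + c * (x \in K)%:R)).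
apply: le_trans (dr x); rewrite esum_mkcond; apply: le_esum => y _.
by case: ifP => // _; rewrite lee_fin mulr_ge0.
Qed.

Lemma Pout_ge0 x : 0 <= Pout P v A x.
Proof.
by rewrite -lee_fin PoutE taboo_step_ge0// => y; rewrite lee_fin.
Qed.

(** The value of [v] on leaving [A] before [z] is at most the reward [v] collected
    from then on until [z] is hit. *)
Lemma kappa_lo_Pout_le x : x \in B ->
  ((kappa_lo P K z v A x + kappa_lo P K z (Pout P v A) A x)%:E <=
   green P [set~ z] (fun y => (v y)%:E) x)%E.
Proof.
move=> xB; rewrite -kappa_loD// kappa_lo_green//; last first.
  by move=> y; rewrite addr_ge0// Pout_ge0.
have vE0 y : (0 <= (v y)%:E)%E by rewrite lee_fin.
have g0 y : (0 <= green P [set~ z] (fun w => (v w)%:E) y)%E by exact: green_ge0.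
apply: green_le => // y; first by rewrite lee_fin addr_ge0// Pout_ge0.
apply: le_trans (taboo_step_green_le P P0 [set~ z] _ y vE0).
rewrite EFinD -addeA leeD2l// PoutE.
(* A step avoiding [z] goes either into [B] or out of [A]; in the latter case the
   Green function of [v] is bounded below by its first term [v]. *)
rewrite [leRHS](esumID [set` B]); last first.
  by move=> w _; rewrite mule_ge0 ?lee_fin.
rewrite addeC; apply: leeD.
  rewrite (_ : [set~ z] `&` [set` B] = [set` B])//.
  apply/setIidr => w /=; rewrite !inE => /andP[wz _]; exact/eqP.
rewrite (_ : [set~ z] `&` ~` [set` B] = [set y | y \notin A]); last first.
  apply/seteqP; split => w /=; rewrite !inE.
    by move=> [/eqP wz]; rewrite wz/= => /negP.
  move=> wA; split; last by apply/negP; rewrite negb_and wA orbT.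
  by move=> wz; move: wA; rewrite wz KA.
apply: le_taboo_step => // w _.
by have := sum_le_green P P0 [set~ z] _ 1%N w vE0; rewrite big_nat1.
Qed.

Lemma invG_app_beta x : x \in K -> invG_app P K z A (beta P K q v A) x =
  kappa_lo P K z q A x + kappa_lo P K z (Pout P v A) A x.
Proof.
by move=> xK; rewrite /kappa_lo xK -[RHS]fin_stepD.
Qed.

Lemma kappa_up_KE x : x \in K -> kappa_up_K P K z q v A x =
  kappa_lo P K z q A x + kappa_lo P K z (Pout P v A) A x +
  kappa_lo P K z (exit_prob P A) A x *
    (maxnorm Kz (invG_app P K z A (beta P K q v A)) / (1 - xi_norm P K z A)).
Proof. by move=> xK; rewrite /kappa_up_K invG_app_beta// invG_app_xi. Qed.

Lemma kappa_upE x : x \in A' -> kappa_up P K z q v A x =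
  kappa_lo P K z q A x + kappa_lo P K z (Pout P v A) A x +
  (kappa_lo P K z (exit_prob P A) A x - xi P K A x) *
    (maxnorm Kz (invG_app P K z A (beta P K q v A)) / (1 - xi_norm P K z A)) +
  xi P K A x * maxnorm Kz (kappa_up_K P K z q v A).
Proof.
move=> xA'; have xK : x \notin K by move: xA'; rewrite !inE => /andP[].
have xA : x \in A by move: xA'; rewrite !inE => /andP[].
rewrite /kappa_up (negbTE xK) kappa_lo_exitE// (addrC (xi P K A x)) addrK.
congr (_ + _); rewrite -!/Kz.
set rho := _ / _.
have -> : beta P K q v A x = kfun P K q A x + kfun P K (Pout P v A) A x by [].
have -> : \sum_(y <- Kz) invP22_P21 P K A x y * kappa_up_K P K z q v A y =
   \sum_(y <- Kz) invP22_P21 P K A x y * kappa_lo_K P K z q A y +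
   \sum_(y <- Kz) invP22_P21 P K A x y * kappa_lo_K P K z (Pout P v A) A y +
   (\sum_(y <- Kz) invP22_P21 P K A x y * invG_app P K z A (xi P K A) y) * rho.
  rewrite mulr_suml -!big_split/= big_seq [RHS]big_seq; apply: eq_bigr => y.
  rewrite !inE => /andP[_ yK].
  by rewrite kappa_up_KE// -invG_app_xi// /kappa_lo yK -/rho; ring.
by rewrite {1 2}/kappa_lo (negbTE xK); ring.
Qed.

End Overshoot.
End TruncatedChain.

(** * Passage to the limit *)

Lemma cvg_maxnorm {R : realType} {S : countType} (D : {fset S})
    (u : nat -> S -> R) (l : S -> R) :
  (forall y, y \in D -> u n y @[n --> \oo] --> l y) ->
  maxnorm D (u n) @[n --> \oo] --> maxnorm D l.
Proof.
rewrite /maxnorm => ul.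
have {}ul y : y \in (D : seq S) -> u n y @[n --> \oo] --> l y by exact: ul.
elim: (D : seq S) ul => [|a s IH] ul.
  rewrite big_nil (_ : (fun n => _) = cst 0); first exact: cvg_cst.
  by apply/funext => n; rewrite big_nil.
rewrite big_cons maxr_absE.
rewrite (_ : (fun n => _) = fun n => (`|u n a| + \big[Num.max/0]_(x <- s) `|u n x|
  + `| `|u n a| - \big[Num.max/0]_(x <- s) `|u n x| |) / 2); last first.
  by apply/funext => n; rewrite big_cons maxr_absE.
have ca : `|u n a| @[n --> \oo] --> `|l a|.
  by apply: cvg_norm; apply: ul; rewrite mem_head.
have cs := IH (fun y ys => ul y (mem_behead (s := a :: s) ys)).
apply: cvgM; last exact: cvg_cst.
by apply: cvgD; [exact: cvgD | apply: cvg_norm; exact: cvgB].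
Qed.

Section Limits.
Context {R : realType} {S : countType} (P : S -> S -> R) (K : {fset S}) (z : S)
  (A : nat -> {fset S}).
Context (P_stoch : stochastic P).
Context (Q_decay : forall x,
  iter n (taboo_step P [set~ z]) (cst 1%E) x @[n --> \oo] --> 0%E).
Context (zK : z \in K).
Context (KA0 : {subset K <= A 0%N}).
Context (A_incr : forall n, {subset A n <= A n.+1}).
Context (A_exhaust : forall x, exists n, x \in A n).
Implicit Types (h u q v : S -> R) (x y : S).

Let P0 x y : 0 <= P x y. Proof. by case: P_stoch. Qed.

Let A_mono m n : (m <= n)%N -> {subset A m <= A n}.
Proof.
move=> /subnK <-; elim: (n - m)%N => // k IH x xA.
by rewrite addSn; apply: A_incr; exact: IH.
Qed.

Let KA n : {subset K <= A n}.
Proof. by move=> x /KA0; exact: A_mono. Qed.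

Lemma near_mem_trunc x : \forall n \near \oo, x \in A n.
Proof.
have [m xm] := A_exhaust x.
by exists m => // n /= mn; exact: A_mono xm.
Qed.

Let near_memB x : x != z -> \forall n \near \oo, x \in (A n `\ z)%fset.
Proof.
move=> xz; near=> n; rewrite !inE xz /=; near: n; exact: near_mem_trunc.
Unshelve. all: by end_near. Qed.

Let memA x n : x \notin K -> x \in A n -> x \in Atrunc K (A n).
Proof. by move=> xK xA; rewrite !inE xK. Qed.

Lemma kappa_lo_cvg h x : (forall y, 0 <= h y) -> x != z ->
  (kappa_lo P K z h (A n) x)%:E @[n --> \oo] -->
  green P [set~ z] (fun y => (h y)%:E) x.
Proof.
move=> h0 xz.
have cv : green P [set` (A n `\ z)%fset] (fun y => (h y)%:E) x @[n --> \oo] -->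
    green P [set~ z] (fun y => (h y)%:E) x.
  apply: green_cvg => // [n y /=|n y /=|y /= yz].
  - by rewrite !inE => /andP[-> /A_incr ->].
  - by rewrite !inE => /andP[/eqP].
  - by have [n yn] := A_exhaust y; exists n; rewrite !inE yn andbT; exact/eqP.
apply: cvg_trans cv; apply: near_eq_cvg; near=> n.
rewrite (kappa_lo_green P K (A n) z P_stoch Q_decay zK (KA n))//.
by near: n; exact: near_memB.
Unshelve. all: by end_near. Qed.

Lemma kappa_lo_mono h x m n : (forall y, 0 <= h y) -> x != z -> (m <= n)%N ->
  x \in A m -> kappa_lo P K z h (A m) x <= kappa_lo P K z h (A n) x.
Proof.
move=> h0 xz mn xm; rewrite -lee_fin.
rewrite !(kappa_lo_green P K (A _) z P_stoch Q_decay zK (KA _))//; last 2 first.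
- by rewrite !inE xz (A_mono _ _ mn).
- by rewrite !inE xz.
apply: le_green => // y /=; rewrite !inE => /andP[-> /=]; exact: A_mono.
Qed.

Lemma kappa_lo_exit_cvg x : x != z ->
  kappa_lo P K z (exit_prob P (A n)) (A n) x @[n --> \oo] --> 0.
Proof.
move=> xz.
have cv : kappa_lo P K z (P ^~ z) (A n) x @[n --> \oo] --> (1 : R).
  rewrite (_ : (fun n => _) = fine \o (fun n => (kappa_lo P K z (P ^~ z) (A n) x)%:E))//.
  apply: fine_cvg; rewrite -(green_hit P z P_stoch Q_decay x).
  exact: kappa_lo_cvg.
have {}cv : 1 - kappa_lo P K z (P ^~ z) (A n) x @[n --> \oo] --> (0 : R).
  by rewrite -[X in _ --> X](subrr 1); apply: cvgB => //; exact: cvg_cst.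
apply: cvg_trans cv; apply: near_eq_cvg; near=> n.
rewrite (kappa_lo_exit P K (A n) z P_stoch Q_decay zK (KA n))//.
by near: n; exact: near_memB.
Unshelve. all: by end_near. Qed.

Section Upper.
Context (q v v' : S -> R) (c c' : R).
Context (q0 : forall x, 0 <= q x).
Context (v0 : forall x, 0 <= v x).
Context (v'0 : forall x, 0 <= v' x).
Context (dr : drift P K v q c).
Context (dr' : drift P K v' v c').
Let f x := fine (green P [set~ z] (fun y => (q y)%:E) x).

Let gfin x : green P [set~ z] (fun y => (v y)%:E) x \is a fin_num.
Proof. exact: (green_drift_fin P z P_stoch Q_decay K v' v c'). Qed.

Let lo_cvg h x : (forall y, 0 <= h y) -> x != z ->
  green P [set~ z] (fun y => (h y)%:E) x \is a fin_num ->
  kappa_lo P K z h (A n) x @[n --> \oo] -->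
  fine (green P [set~ z] (fun y => (h y)%:E) x).
Proof.
move=> h0 xz hfin.
rewrite (_ : (fun n => _) = fine \o (fun n => (kappa_lo P K z h (A n) x)%:E))//.
by apply: fine_cvg; rewrite fineK//; exact: kappa_lo_cvg.
Qed.

Lemma kappa_lo_Pout_cvg x : x != z ->
  kappa_lo P K z (Pout P v (A n)) (A n) x @[n --> \oo] --> 0.
Proof.
move=> xz.
pose g := fine (green P [set~ z] (fun y => (v y)%:E) x).
have cv : g - kappa_lo P K z v (A n) x @[n --> \oo] --> (0 : R).
  rewrite -[X in _ --> X](subrr g); apply: cvgB; first exact: cvg_cst.
  exact: lo_cvg.
apply: (squeeze_cvgr _ (cvg_cst 0) cv); near=> n.
have xB : x \in (A n `\ z)%fset by near: n; exact: near_memB.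
rewrite (kappa_lo_ge0 P K (A n) z P_stoch Q_decay zK (KA n))//=; last first.
  by move=> y; exact: (Pout_ge0 P K (A n) P_stoch v q c).
rewrite lerBrDl -lee_fin fineK//.
exact: (kappa_lo_Pout_le P K (A n) z P_stoch Q_decay zK (KA n) v q c).
Unshelve. all: by end_near. Qed.

Let sum_cvg x : x != z ->
  kappa_lo P K z q (A n) x + kappa_lo P K z (Pout P v (A n)) (A n) x
    @[n --> \oo] --> f x.
Proof.
move=> xz; rewrite -[f x]addr0; apply: cvgD; last exact: kappa_lo_Pout_cvg.
apply: lo_cvg => //.
exact: (green_drift_fin P z P_stoch Q_decay K v q c).
Qed.

Let Kz := Ktilde K z.

Lemma xi_norm_cvg : xi_norm P K z (A n) @[n --> \oo] --> 0.
Proof.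
rewrite (_ : 0 = maxnorm Kz (fun=> 0 : R)); last first.
  by rewrite /maxnorm big1_idem//= ?maxxx// => y _; rewrite normr0.
apply: cvg_maxnorm => y; rewrite !inE => /andP[yz yK].
rewrite (_ : (fun n => _) =
  fun n => kappa_lo P K z (exit_prob P (A n)) (A n) y); last first.
  by apply/funext => n; rewrite (invG_app_xi P K (A n) z P_stoch Q_decay zK (KA n)).
exact: kappa_lo_exit_cvg.
Qed.

Let rho n := maxnorm Kz (invG_app P K z (A n) (beta P K q v (A n))) /
  (1 - xi_norm P K z (A n)).

Let rho_cvg : rho n @[n --> \oo] --> maxnorm Kz f.
Proof.
rewrite -[X in _ --> X]divr1; apply: cvgM.
  apply: cvg_maxnorm => y; rewrite !inE => /andP[yz yK].
  rewrite (_ : (fun n => _) = fun n => kappa_lo P K z q (A n) y +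
    kappa_lo P K z (Pout P v (A n)) (A n) y); first exact: sum_cvg.
  by apply/funext => n; rewrite invG_app_beta.
apply: cvgV; first exact: oner_neq0.
rewrite -[X in _ --> X]subr0; apply: cvgB; [exact: cvg_cst|exact: xi_norm_cvg].
Qed.

Lemma kappa_up_K_cvg x : x != z -> x \in K ->
  kappa_up_K P K z q v (A n) x @[n --> \oo] --> f x.
Proof.
move=> xz xK.
rewrite (_ : (fun n => _) = fun n => kappa_lo P K z q (A n) x +
    kappa_lo P K z (Pout P v (A n)) (A n) x +
    kappa_lo P K z (exit_prob P (A n)) (A n) x * rho n); last first.
  apply/funext => n.
  by rewrite (kappa_up_KE P K (A n) z P_stoch Q_decay zK (KA n)).
rewrite -[f x]addr0 -(mul0r (maxnorm Kz f)); apply: cvgD; first exact: sum_cvg.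
by apply: cvgM => //; exact: kappa_lo_exit_cvg.
Qed.

Let M_cvg : maxnorm Kz (kappa_up_K P K z q v (A n)) @[n --> \oo] --> maxnorm Kz f.
Proof.
apply: cvg_maxnorm => y; rewrite !inE => /andP[yz yK].
exact: kappa_up_K_cvg.
Qed.

Lemma kappa_up_cvg x : x != z -> kappa_up P K z q v (A n) x @[n --> \oo] --> f x.
Proof.
move=> xz; have [xK|xK] := boolP (x \in K).
  rewrite (_ : (fun n => _) = fun n => kappa_up_K P K z q v (A n) x).
    exact: kappa_up_K_cvg.
  by apply/funext => n; rewrite /kappa_up xK.
have ecv := kappa_lo_exit_cvg x xz.
have xi_cvg : xi P K (A n) x @[n --> \oo] --> 0.
  apply: (squeeze_cvgr _ (cvg_cst 0) ecv); near=> n.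
  apply: (xi_bounds P K (A n) z P_stoch Q_decay zK (KA n)).
  by apply: memA => //; near: n; exact: near_mem_trunc.
have cv : kappa_lo P K z q (A n) x + kappa_lo P K z (Pout P v (A n)) (A n) x +
    (kappa_lo P K z (exit_prob P (A n)) (A n) x - xi P K (A n) x) * rho n +
    xi P K (A n) x * maxnorm Kz (kappa_up_K P K z q v (A n)) @[n --> \oo] --> f x.
  rewrite -[f x]addr0 -(mul0r (maxnorm Kz f)); apply: cvgD; last exact: cvgM.
  rewrite -[f x]addr0 -(mul0r (maxnorm Kz f)); apply: cvgD; first exact: sum_cvg.
  apply: cvgM => //; rewrite -[X in _ --> X](subrr 0); exact: cvgB.
apply: cvg_trans cv; apply: near_eq_cvg; near=> n.
rewrite (kappa_upE P K (A n) z P_stoch Q_decay zK (KA n))//.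
by apply: memA => //; near: n; exact: near_mem_trunc.
Unshelve. all: by end_near. Qed.

End Upper.
End Limits.

Theorem mainTheorem2 (R : realType) (S : countType)
    (d : measure_display) (Omega : measurableType d)
    (P : S -> S -> R) (X : nat -> Omega -> S) (Pr : S -> probability Omega R)
    (K : {fset S}) (z : S) (q v : S -> R) (c : R) (A : nat -> {fset S})
    (hX : markov_chain P X Pr)
    (hirr : irreducible_chain X Pr)
    (hrec : recurrent_chain X Pr)
    (hz : z \in K)
    (hq : forall x, 0 <= q x)
    (hv : forall x, 0 <= v x)
    (hdrift : drift P K v q c)
    (hKA : {subset K <= A 0%N})
    (hA : forall n, {subset A n <= A n.+1})
    (hAS : forall x, exists n, x \in A n) :
  (forall x, x != z ->
     [/\ cycle_reward X Pr z q x \is a fin_num,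
         forall m n, (m <= n)%N -> x \in A m ->
           kappa_lo P K z q (A m) x <= kappa_lo P K z q (A n) x
       & (kappa_lo P K z q (A n) x)%:E @[n --> \oo]
           --> cycle_reward X Pr z q x])
  /\
  ((exists (v' : S -> R) (c' : R),
      (forall x, 0 <= v' x) /\ drift P K v' v c') ->
   forall x, x != z ->
     (\forall n \near \oo, x \in A n /\ xi_norm P K z (A n) < 1)
     /\ (kappa_up P K z q v (A n) x)%:E @[n --> \oo]
          --> cycle_reward X Pr z q x).
Proof.
have P_stoch : stochastic P by case: hX.
have P0 x y : 0 <= P x y by case: P_stoch.
have Q_decay x : iter n (taboo_step P [set~ z]) (cst 1%E) x @[n --> \oo] --> 0%E.
  exact: (stays_cvg0 P X Pr hX).
have fin x : cycle_reward X Pr z q x \is a fin_num.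
  rewrite (cycle_reward_green P X Pr hX)//.
  exact: (green_drift_fin P z P_stoch Q_decay K v q c).
split => [x xz|[v' [c' [v'0 dr']]] x xz].
  split => //.
    by move=> m n mn xm; exact: (kappa_lo_mono P K z A P_stoch Q_decay hz hKA hA).
  rewrite (cycle_reward_green P X Pr hX)//.
  exact: (kappa_lo_cvg P K z A P_stoch Q_decay hz hKA hA hAS).
split.
  have xi1 : \forall n \near \oo, xi_norm P K z (A n) < 1.
    apply: (cvgr_lt 0); last exact: ltr01.
    exact: (xi_norm_cvg P K z A P_stoch Q_decay hz hKA hA hAS).
  near=> n; split; near: n => //.
  exact: (near_mem_trunc A hA hAS).
rewrite -(fineK (fin x)); apply: cvg_EFin; first exact: nearW.
rewrite (cycle_reward_green P X Pr hX)//=.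
exact: (kappa_up_cvg P K z A P_stoch Q_decay hz hKA hA hAS q v v' c c').
Unshelve. all: by end_near. Qed.
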